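(* Fix $c>0$, $\rho>0$, $l_0\ge1$, $\alpha\in(0,1)$ and define $$\mathrm{GP}_\alpha(v)=\sup\left\{s\ge0:\ m(s,v)<\frac{l_0}{\alpha}\right\},$$ $$m(s,v)=\frac{\left(\frac{\rho}{c^2}\right)^{\rho/c^2}}{\Gamma\left(\frac{\rho}{c^2}\right)\bar\gamma\left(\frac{\rho}{c^2},\frac{\rho}{c^2}\right)}\cdot\frac{\Gamma\left(\frac{cs+v+\rho}{c^2}\right)\bar\gamma\left(\frac{cs+v+\rho}{c^2},\frac{v+\rho}{c^2}\right)}{\left(\frac{v+\rho}{c^2}\right)^{(cs+v+\rho)/c^2}}\exp\left\{\frac{v}{c^2}\right\}.$$ Then $\mathrm{GP}_\alpha$ is an $l_0$-sub-Poisson uniform boundary with crossing probability $\alpha$ for scale $c$.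
   Context: $\bar\gamma(a,x)=\left(\int_x^\infty u^{a-1}e^{-u}\,du\right)/\Gamma(a)$ is the regularized upper incomplete gamma function. Sub-$\psi$ condition: let $(S_t)_{t=0}^\infty$, $(V_t)_{t=0}^\infty$ be real-valued processes adapted to a filtration $(\mathcal F_t)_{t=0}^\infty$ with $S_0=V_0=0$ and $V_t\ge 0$ for all $t$. For $\psi:[0,\lambda_{\max})\to\mathbb{R}$ and $l_0\in[1,\infty)$, $(S_t)$ is $l_0$-sub-$\psi$ with variance process $(V_t)$ if for each $\lambda\in[0,\lambda_{\max})$ there is a supermartingale $(L_t(\lambda))_{t=0}^\infty$ with respect to $(\mathcal F_t)$ with $\mathbb{E}L_0(\lambda)\le l_0$ and $\exp\{\lambda S_t-\psi(\lambda)V_t\}\le L_t(\lambda)$ a.s. for all $t$. Uniform boundary: $u$ is an $l_0$-sub-$\psi$ uniform boundary with crossing probability $\alpha$ if $\mathbb{P}(\exists t\ge 1: S_t\ge u(V_t))\le\alpha$ for every pair $(S_t,V_t)$ such that $(S_t)$ is $l_0$-sub-$\psi$ with variance process $(V_t)$. Sub-Poisson with scale $c>0$ means sub-$\psi$ with $\psi(\lambda)=\psi_{P,c}(\lambda)=c^{-2}(e^{c\lambda}-c\lambda-1)$ on $[0,\infty)$. *)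

(* Defs.v *)
From HB Require Import structures.
From mathcomp Require Import all_boot all_order all_algebra.
From mathcomp Require Import all_classical all_reals all_analysis.
Import Order.TTheory GRing.Theory Num.Theory.
Import numFieldNormedType.Exports.

Local Open Scope classical_set_scope.
Local Open Scope ring_scope.

Definition is_filtration d (T : measurableType d) (F : nat -> set (set T)) :
    Prop :=
  [/\ forall t, sigma_algebra setT (F t),
      forall t, F t `<=` measurable &
      forall s t, (s <= t)%N -> F s `<=` F t].

Definition rv_wrt d (T : measurableType d) (R : realType)
    (G : set (set T)) (X : T -> R) : Prop :=
  forall B : set R, measurable B -> G (X @^-1` B).

Definition adapted d (T : measurableType d) (R : realType)
    (F : nat -> set (set T)) (X : nat -> T -> R) : Prop :=
  forall t, rv_wrt d T R (F t) (X t).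

(* [Y] is a version of the conditional expectation of [X] given [G] *)
Definition is_cond_expectation d (T : measurableType d) (R : realType)
    (P : probability T R) (G : set (set T)) (X Y : T -> R) : Prop :=
  [/\ rv_wrt d T R G Y,
      P.-integrable setT (EFin \o Y) &
      forall A, G A ->
        (\int[P]_(w in A) (Y w)%:E = \int[P]_(w in A) (X w)%:E)%E].

Definition supermartingale d (T : measurableType d) (R : realType)
    (P : probability T R) (F : nat -> set (set T)) (L : nat -> T -> R) : Prop :=
  [/\ adapted d T R F L,
      forall t, P.-integrable setT (EFin \o L t) &
      forall t, exists2 Y : T -> R,
        is_cond_expectation d T R P (F t) (L t.+1) Y &
        {ae P, forall w, Y w <= L t w}].

(* [lmax] is extended real so that the domain of [psi] may be all of
   [0, +oo); the values of [psi] outside [0, lmax) are irrelevant. *)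
Definition sub_psi (R : realType) (psi : R -> R) (lmax : \bar R) (l0 : R)
    d (T : measurableType d) (P : probability T R)
    (F : nat -> set (set T)) (S V : nat -> T -> R) : Prop :=
  [/\ is_filtration d T F,
      adapted d T R F S /\ adapted d T R F V,
      (forall w, S 0%N w = 0) /\ (forall w, V 0%N w = 0),
      forall t w, 0 <= V t w &
      forall lam : R, 0 <= lam -> (lam%:E < lmax)%E ->
        exists L : nat -> T -> R,
          [/\ supermartingale d T R P F L,
              ('E_P[L 0%N] <= l0%:E)%E &
              forall t, {ae P, forall w,
                expR (lam * S t w - psi lam * V t w) <= L t w}]].

(* The measure [P] is only meaningful on measurable sets, so the bound on the
   crossing probability is accompanied by the measurability of the event. *)
Definition uniform_boundary (R : realType) (psi : R -> R) (lmax : \bar R)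
    (l0 alpha : R) (u : R -> R) : Prop :=
  forall d (T : measurableType d) (P : probability T R)
    (F : nat -> set (set T)) (S V : nat -> T -> R),
    sub_psi R psi lmax l0 d T P F S V ->
    let crossing := [set w | exists t, (1 <= t)%N /\ u (V t w) <= S t w] in
    measurable crossing /\ (P crossing <= alpha%:E)%E.

Definition psi_poisson (R : realType) (c lam : R) : R :=
  (c ^+ 2)^-1 * (expR (c * lam) - c * lam - 1).

Definition sub_poisson_uniform_boundary (R : realType) (c l0 alpha : R)
    (u : R -> R) : Prop :=
  uniform_boundary R (psi_poisson R c) +oo%E l0 alpha u.

(* Converges for a > 0, the only case of interest. *)
Definition Gamma (R : realType) (a : R) : R :=
  \int[lebesgue_measure]_(u in `]0, +oo[) (u `^ (a - 1) * expR (- u)).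

Definition reg_upper_gamma (R : realType) (a x : R) : R :=
  (\int[lebesgue_measure]_(u in `]x, +oo[) (u `^ (a - 1) * expR (- u)))
    / Gamma R a.

Definition gamma_poisson_mixture (R : realType) (c rho s v : R) : R :=
  let k := rho / c ^+ 2 in
  let a := (c * s + v + rho) / c ^+ 2 in
  let x := (v + rho) / c ^+ 2 in
  k `^ k / (Gamma R k * reg_upper_gamma R k k)
  * (Gamma R a * reg_upper_gamma R a x / x `^ a)
  * expR (v / c ^+ 2).

(* For v >= 0 the set below contains 0 (when alpha < 1 <= l0) and is bounded
   above, so that the real-valued [sup] is a genuine least upper bound. *)
Definition GP (R : realType) (c rho l0 alpha v : R) : R :=
  sup [set s : R | 0 <= s /\ gamma_poisson_mixture R c rho s v < l0 / alpha].

(* Main.v *)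
(** Substituting y = e^(c lambda), the function m is the mixture, over y in
    (1, +oo) with density proportional to y^(k-1) e^(-ky), k = rho / c^2, of the
    exponentials exp(lambda s - psi(lambda) v).  For v >= 0 it is nondecreasing,
    convex and unbounded in s >= 0, hence s >= GP(v) iff s >= 0 and
    m(s, v) >= l0 / alpha.

    The supermartingales L(lambda) need not be measurable in lambda, so they
    cannot be mixed.  Instead, for each fixed lambda, stopping L(lambda) at the
    first time t < N where m(S_t, V_t) >= l0 / alpha bounds the expectation of
    the stopped exponential by l0.  These bounds only involve the jointly
    measurable exponentials; Tonelli's theorem integrates them over y and gives
    (l0 / alpha) P(crossing before N) <= l0. *)
Require Import Defs.
From HB Require Import structures.
From mathcomp Require Import all_boot all_order all_algebra.
From mathcomp Require Import all_classical all_reals all_analysis measurable_realfun.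
From mathcomp Require Import ring lra.
Import Order.TTheory GRing.Theory Num.Theory.
Import numFieldNormedType.Exports.
Local Open Scope classical_set_scope.
Local Open Scope ring_scope.

Set Implicit Arguments.
Unset Strict Implicit.
Unset Printing Implicit Defensive.

(** * Almost sure comparison of integrals; sigma-algebras as families of sets *)

(** The minimum of [f] and [g] is almost everywhere [f] and everywhere at most [g], so pointwise
    monotonicity of the integral applies to it, for functions of any sign. *)
Lemma ae_le_integral d (T : measurableType d) (R : realType)
    (mu : {measure set T -> \bar R}) (D : set T) (f g : T -> \bar R) :
  measurable D -> mu.-integrable D f -> mu.-integrable D g ->
  {ae mu, forall x, D x -> (f x <= g x)%E} ->
  (\int[mu]_(x in D) f x <= \int[mu]_(x in D) g x)%E.
Proof.
move=> mD intf intg fg.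
have mf := measurable_int _ intf; have mg := measurable_int _ intg.
have intm : mu.-integrable D (fun x => mine (f x) (g x)).
  have intfg : mu.-integrable D (fun x => `|f x| + `|g x|)%E.
    by apply: integrableD => //; exact: integrable_abse.
  apply: (le_integrable _ _ _ intfg) => //; first exact: measurable_mine.
  move=> x _; rewrite [leRHS]gee0_abs ?adde_ge0//.
  by rewrite /mine; case: ifPn => _; [exact: leeDl|exact: leeDr].
rewrite (@ae_eq_integral _ _ _ mu D (fun x => mine (f x) (g x)) f)//.
- by apply: le_integral => // x _; rewrite ge_min lexx orbT.
- exact: measurable_mine.
- by apply: filterS fg => x fgx Dx; rewrite min_l ?fgx.
Qed.

Lemma rv_wrt_measurable_fun d (T : measurableType d) (R : realType)
    (G : set (set T)) (X : T -> R) :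
  G `<=` measurable -> rv_wrt d T R G X -> measurable_fun setT X.
Proof. by move=> GT GX _ B mB; rewrite setTI; apply: GT; exact: GX. Qed.

(** A sigma-algebra [G] is the family of measurable sets of the space it generates, so closure
    properties of measurable sets carry over to [G]. *)
Lemma sigma_algebra_bigsetU {T : pointedType} (G : set (set T))
    (D : nat -> set T) n : sigma_algebra setT G ->
  (forall k, (k < n)%N -> G (D k)) -> G (\big[setU/set0]_(k < n) D k).
Proof.
move=> sG; elim: n => [_|n ih GD].
  by rewrite big_ord0 -(measurable_g_measurableTypeE sG); exact: measurable0.
rewrite big_ord_recr/=; have := GD n (leqnn _); have := ih (fun k kn => GD k (ltnW kn)).
rewrite -[G in G _](measurable_g_measurableTypeE sG).
rewrite -[G in _ -> G _ -> _](measurable_g_measurableTypeE sG).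
rewrite -[G in _ -> _ -> G _](measurable_g_measurableTypeE sG).
exact: measurableU.
Qed.

Lemma sigma_algebra_setC {T : pointedType} (G : set (set T)) (A : set T) :
  sigma_algebra setT G -> G A -> G (~` A).
Proof.
move=> sG; rewrite -(measurable_g_measurableTypeE sG); exact: measurableC.
Qed.

(** * Stopping a supermartingale at the first entrance into [D] *)

(** The left side is the expectation of [L] at the first entrance time capped at [N]. In the
    induction step, paths that have not entered before [N] are split by whether they enter at [N];
    on those that do not, an event of [F N], passing from [L N] to [L N.+1] does not increase the
    integral. *)
Lemma supermartingale_first_hit d (T : measurableType d) (R : realType)
    (P : probability T R) (F : nat -> set (set T)) (L : nat -> T -> R)
    (D : nat -> set T) (N : nat) :
  is_filtration d T F -> supermartingale d T R P F L ->
  (forall t, F t (D t)) ->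
  (\sum_(t < N) \int[P]_(w in seqDU D t) (L t w)%:E +
   \int[P]_(w in ~` \big[setU/set0]_(k < N) D k) (L N w)%:E
   <= \int[P]_w (L 0%N w)%:E)%E.
Proof.
move=> [sF Fm ndF] [_ intL condL] FD.
(* Not having entered up to and including time [t] is decided at time [t]. *)
have FBS t : F t (~` \big[setU/set0]_(k < t.+1) D k).
  apply: sigma_algebra_setC => //.
  apply: (@sigma_algebra_bigsetU T (F t) D t.+1) => // k kt.
  exact: (ndF k t kt).
have mD t : measurable (D t) by exact: Fm.
have mU n : measurable (\big[setU/set0]_(k < n) D k) by exact: bigsetU_measurable.
have intLA (A : set T) t : measurable A -> P.-integrable A (EFin \o L t).
  by move=> mA; exact: (integrableS measurableT mA _ (intL t)).
elim: N => [|N ih]; first by rewrite !big_ord0 add0e setC0.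
apply: le_trans ih.
rewrite big_ord_recr/= -addeA leeD2l//.
have -> : ~` (\big[setU/set0]_(k < N) D k) =
    seqDU D N `|` ~` (\big[setU/set0]_(k < N.+1) D k).
  rewrite big_ord_recr/= /seqDU; apply/seteqP; split => x /=.
    by move=> nDx; have [DNx|DNx] := pselect (D N x); [left|right => -[]].
  by move=> [[]//|nDx Dx]; apply: nDx; left.
have mA : measurable (seqDU D N) by exact: measurableD.
have mB : measurable (~` (\big[setU/set0]_(k < N.+1) D k)) by exact: measurableC.
rewrite integral_setU//; last 2 first.
- by apply: measurable_funTS; exact: measurable_int (intL N).
- apply/disj_set2P; rewrite /seqDU big_ord_recr/= -subset0 => x [[DNx _]] /=.
  by apply; right.
apply: leeD2l; have [Y [mY intY condY] YL] := condL N.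
rewrite -condY; last exact: FBS.
apply: ae_le_integral.
- exact: mB.
- exact: (integrableS measurableT mB _ intY).
- exact: intLA.
- by apply: filterS YL => w YLw _; rewrite lee_fin.
Qed.

(* [seqDU D t] is the event that the process enters [D] for the first time at [t]. *)
Lemma sub_psi_first_hit (R : realType) (psi : R -> R) (lmax : \bar R) (l0 : R)
    d (T : measurableType d) (P : probability T R)
    (F : nat -> set (set T)) (S V : nat -> T -> R) (D : nat -> set T)
    (lam : R) (N : nat) :
  sub_psi R psi lmax l0 d T P F S V -> 0 <= lam -> (lam%:E < lmax)%E ->
  (forall t, F t (D t)) ->
  (\sum_(t < N) \int[P]_(w in seqDU D t)
     (expR (lam * S t w - psi lam * V t w))%:E <= l0%:E)%E.
Proof.
move=> [filF [adS adV] _ _ subL] lam0 lamlt FD.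
have [L [supL EL leL]] := subL lam lam0 lamlt.
have [_ Fm _] := filF; have [_ intL _] := supL.
have mD t : measurable (D t) by exact: Fm.
have mA t : measurable (seqDU D t) by exact: seqDU_measurable.
have mS t : measurable_fun setT (S t) := rv_wrt_measurable_fun (Fm t) (adS t).
have mV t : measurable_fun setT (V t) := rv_wrt_measurable_fun (Fm t) (adV t).
move: EL; rewrite unlock; apply: le_trans.
apply: le_trans (supermartingale_first_hit N filF supL FD).
(* The added zero bounds from below the integral over paths not entering before [N], since [L N]
   dominates an exponential almost surely. *)
rewrite -[leLHS]adde0; apply: leeD.
  apply: lee_sum => t _.
  set f := fun w => expR (lam * S t w - psi lam * V t w).
  have mf : measurable_fun setT f.
    apply: measurableT_comp => //; apply: measurable_funB.
      exact: measurable_funM.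
    exact: measurable_funM.
  have intf : P.-integrable setT (EFin \o f).
    apply/integrableP; split; first exact/measurable_EFinP.
    have /integrableP[_] := intL t.
    apply: le_lt_trans; apply: ae_ge0_le_integral => //.
    - by apply: measurableT_comp => //; exact/measurable_EFinP.
    - by apply: measurableT_comp => //; exact: measurable_int (intL t).
    - apply: filterS (leL t) => w fL _ /=; rewrite lee_fin.
      by rewrite ger0_norm ?expR_ge0// (le_trans fL)// ler_norm.
  apply: ae_le_integral => //.
  - exact: (integrableS measurableT _ _ intf).
  - exact: (integrableS measurableT _ _ (intL t)).
  - by apply: filterS (leL t) => w fL _; rewrite lee_fin.
have mB : measurable (~` \big[setU/set0]_(k < N) D k).
  by apply: measurableC; exact: bigsetU_measurable.
rewrite -(@integral0 _ _ _ P (~` \big[setU/set0]_(k < N) D k)).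
apply: ae_le_integral => //.
- exact: integrable0.
- exact: (integrableS measurableT _ _ (intL N)).
- by apply: filterS (leL N) => w fL _; rewrite lee_fin (le_trans _ fL)// expR_ge0.
Qed.

(** * Gamma integrals over []1, +oo[] *)

(** The unnormalized gamma density with shape [a] and rate [x]. Keeping the rate inside lets every
    tail start at 1, so tails with different parameters compare pointwise. *)
Definition gamma_density (R : realType) (a x y : R) : R :=
  y `^ (a - 1) * expR (- (x * y)).

(* [x `^ a * gamma_tail1 a x] is the unregularized upper incomplete gamma function at [(a, x)]. *)
Definition gamma_tail1 (R : realType) (a x : R) : R :=
  \int[lebesgue_measure]_(y in `]1, +oo[) gamma_density a x y.

Lemma gamma_density_ge0 (R : realType) (a x y : R) : 0 <= gamma_density a x y.
Proof. by rewrite mulr_ge0 ?powR_ge0 ?expR_ge0. Qed.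

Lemma gamma_densityE (R : realType) (a x y : R) : 0 < y ->
  gamma_density a x y = expR ((a - 1) * ln y - x * y).
Proof. by move=> y0; rewrite /gamma_density /powR gt_eqF// expRD. Qed.

Lemma measurable_gamma_density (R : realType) (a x : R) (D : set R) :
  measurable_fun D (gamma_density a x).
Proof.
apply: measurable_funTS; apply: measurable_funM; first exact: measurable_powR.
by apply: measurableT_comp => //; apply: measurableT_comp => //; exact: measurable_funM.
Qed.

(** Half of the exponential decay absorbs the power of [y]; the other half is an integrable
    majorant. *)
Lemma gamma_density_le (R : realType) (a x : R) : 0 < x ->
  exists C : R, forall y, 1 < y ->
    gamma_density a x y <= C * exponential_pdf (x / 2) y.
Proof.
(* [q] is chosen so that [p / q <= x / 2]; the [+ 1] keeps it positive when [a = 1]. *)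
move=> x0; pose p := `|a - 1|; pose q := 2 * (p + 1) / x.
have p0 : 0 <= p by exact: normr_ge0.
have q0 : 0 < q by rewrite divr_gt0// mulr_gt0// ltr_wpDl.
exists (expR (p * ln q) * (x / 2)^-1) => y y1.
have y0 : 0 < y by exact: lt_trans y1.
rewrite exponential_pdfE ?(ltW y0)// -mulrA mulKf ?gt_eqF ?divr_gt0//.
rewrite gamma_densityE// -expRD ler_expR.
have lny0 : 0 <= ln y by rewrite ln_ge0// ltW.
have lny : ln y <= y / q + ln q.
  have yq0 : 0 < y / q by exact: divr_gt0.
  rewrite -[in leLHS](divfK (lt0r_neq0 q0) y) lnM ?posrE//.
  rewrite lerD2r -[in leLHS](addrNK 1 (y / q)) addrC.
  apply: le_trans (le_ln1Dx _) _; last by rewrite gerBl.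
  by rewrite -subr_gt0 opprK addrNK.
have h1 : (a - 1) * ln y <= p * (y / q + ln q).
  by apply: (le_trans (ler_wpM2r lny0 (ler_norm _))); rewrite ler_wpM2l.
have h2 : p * (y / q) <= x / 2 * y.
  rewrite mulrCA mulrC ler_wpM2r ?(ltW y0)// ler_pdivrMr//.
  have -> : x / 2 * q = p + 1 by rewrite /q; field; rewrite gt_eqF.
  by rewrite lerDl.
lra.
Qed.

Lemma integrable_gamma_density (R : realType) (a x : R) : 0 < x ->
  lebesgue_measure.-integrable `]1%R, +oo[ (EFin \o gamma_density a x).
Proof.
move=> x0; have [C leC] := gamma_density_le a x0.
have intE : lebesgue_measure.-integrable `]1%R, +oo[
    (EFin \o exponential_pdf (x / 2)).
  apply: (integrableS measurableT) => //; apply/integrableP; split.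
    by apply/measurable_EFinP; exact: measurable_exponential_pdf.
  under eq_integral do
    rewrite /= ger0_norm ?exponential_pdf_ge0 ?divr_ge0 ?(ltW x0)//.
  by rewrite integral_exponential_pdf ?divr_gt0// ltry.
apply: le_integrable (integrableZl _ C intE) => //.
  by apply/measurable_EFinP; exact: measurable_gamma_density.
move=> y /=; rewrite in_itv/= andbT => y1.
rewrite lee_fin ger0_norm ?gamma_density_ge0//.
by rewrite (le_trans (leC _ y1))// ler_norm.
Qed.

Lemma EFin_gamma_tail1 (R : realType) (a x : R) : 0 < x ->
  (gamma_tail1 a x)%:E =
  (\int[lebesgue_measure]_(y in `]1%R, +oo[) (gamma_density a x y)%:E)%E.
Proof.
move=> x0; rewrite /gamma_tail1 /Rintegral fineK//.
by apply: integrable_fin_num => //; exact: integrable_gamma_density.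
Qed.

(** On []2, 3[] each factor of the density is bounded below by its worst value. The growth in [a]
    later bounds the set whose supremum is [GP]. *)
Lemma gamma_tail1_ge (R : realType) (a x : R) : 0 < x -> 0 <= a ->
  2 `^ a / 3 * expR (- (3 * x)) <= gamma_tail1 a x.
Proof.
move=> x0 a0; set r : R := (X in X <= _); rewrite -lee_fin EFin_gamma_tail1//.
have mg D : measurable_fun D (fun y => (gamma_density a x y)%:E).
  by apply/measurable_EFinP; exact: measurable_gamma_density.
have g0 (y : R) : (0 <= (gamma_density a x y)%:E)%E.
  by rewrite lee_fin gamma_density_ge0.
have r0 : 0 <= r by rewrite mulr_ge0 ?expR_ge0// divr_ge0 ?powR_ge0.
apply: (@le_trans _ _ (\int[lebesgue_measure]_(y in `]2%R, 3%R[)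
    (gamma_density a x y)%:E)%E); last first.
  apply: ge0_subset_integral => //; first exact: mg.
  move=> y /=; rewrite !in_itv/= => /andP[y2 _].
  by rewrite andbT (lt_trans _ y2)// ltr1n.
apply: (@le_trans _ _ (\int[lebesgue_measure]_(y in `]2%R, 3%R[) r%:E)%E).
  rewrite integral_cst//= lebesgue_measure_itv/= lte_fin ltr_nat/= -EFinD.
  by rewrite -EFinM lee_fin (_ : 3 - 2 = 1 :> R) ?mulr1//; lra.
apply: ge0_le_integral => //; first exact: mg.
move=> y /=; rewrite in_itv/= => /andP[y2 y3]; rewrite lee_fin.
have y0 : 0 < y by exact: lt_trans y2.
rewrite /r /gamma_density powRB ?(gt_eqF y0) ?implybT//.
rewrite powRr1 ?(ltW y0)//.
apply: ler_pM; rewrite ?expR_ge0 ?divr_ge0 ?powR_ge0//.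
  apply: ler_pM; rewrite ?powR_ge0 ?invr_ge0//.
    by apply: ge0_ler_powR; rewrite ?nnegrE ?(ltW y0) ?(ltW y2).
  by rewrite lef_pV2 ?posrE// ltW.
by rewrite ler_expR lerN2 mulrC ler_wpM2r ?ltW.
Qed.

Lemma gamma_tail1_gt0 (R : realType) (a x : R) : 0 < x -> 0 <= a ->
  0 < gamma_tail1 a x.
Proof.
move=> x0 a0; apply: lt_le_trans (gamma_tail1_ge x0 a0).
by rewrite mulr_gt0 ?expR_gt0// divr_gt0 ?powR_gt0.
Qed.

Lemma le_gamma_tail1 (R : realType) (a b x : R) : 0 < x -> a <= b ->
  gamma_tail1 a x <= gamma_tail1 b x.
Proof.
move=> x0 ab; apply: le_Rintegral => //; try exact: integrable_gamma_density.
move=> y /=; rewrite in_itv/= andbT => y1.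
by rewrite /gamma_density ler_wpM2r ?expR_ge0// ler_powR ?lerD2r// ltW.
Qed.

(** Averaging the tangent bounds taken at the intermediate point [m] cancels the linear terms. *)
Lemma expR_convex (R : realType) (t u v : R) : 0 <= t <= 1 ->
  expR ((1 - t) * u + t * v) <= (1 - t) * expR u + t * expR v.
Proof.
move=> /andP[t0 t1]; set m := (_ + _).
have tangent z : expR m * (1 + (z - m)) <= expR z.
  rewrite -[in leRHS](subrK m z) [in leRHS]expRD mulrC ler_wpM2r ?expR_ge0//.
  exact: expR_ge1Dx.
have -> : expR m = (1 - t) * (expR m * (1 + (u - m))) +
    t * (expR m * (1 + (v - m))) by rewrite /m; ring.
by apply: lerD; apply: ler_wpM2l => //; rewrite subr_ge0.
Qed.

(** For fixed [y] the density is the exponential of an affine function of the shape. *)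
Lemma gamma_tail1_convex (R : realType) (a b x t : R) : 0 < x -> 0 <= t <= 1 ->
  gamma_tail1 ((1 - t) * a + t * b) x <=
  (1 - t) * gamma_tail1 a x + t * gamma_tail1 b x.
Proof.
move=> x0 t01; have intg c := integrable_gamma_density c x0.
have intZ k c : lebesgue_measure.-integrable `]1%R, +oo[
    (EFin \o (fun y => k * gamma_density c x y)).
  exact: (integrableZl _ k (intg c)).
rewrite /gamma_tail1 -!RintegralZl// -RintegralD//.
apply: le_Rintegral => //.
  exact: (integrableD _ (intZ _ _) (intZ _ _)).
move=> y /=; rewrite in_itv/= andbT => y1.
have y0 : 0 < y by exact: lt_trans y1.
rewrite !gamma_densityE//; apply: le_trans (expR_convex _ _ t01).
by rewrite ler_expR le_eqVlt; apply/orP; left; apply/eqP; ring.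
Qed.

(** * Positivity of the Gamma function and scaling of its tail *)

Lemma continuous_powR (R : realType) (p y : R) : 0 < y ->
  {for y, continuous (fun u : R => u `^ p)}.
Proof.
move=> y0; apply: differentiable_continuous; apply/derivable1_diffP.
by have [] := is_derive1_powR p y0.
Qed.

(** The integrand may blow up at 0, so the antiderivative is used on intervals away from 0, followed
    by monotone convergence. *)
Lemma integral_powR01_le (R : realType) (a : R) : 0 < a ->
  (\int[lebesgue_measure]_(u in `]0%R, 1%R]) (u `^ (a - 1))%:E <= a^-1%:E)%E.
Proof.
(* With [n.+2] the left endpoint is strictly below 1 already for [n = 0]. *)
move=> a0; pose F n := `[(n.+2%:R)^-1 : R, 1]%classic.
have -> : `]0%R, 1%R]%classic = \bigcup_n F n.
  apply/seteqP; split => u /=.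
    rewrite in_itv/= => /andP[u0 u1]; exists (Num.truncn u^-1) => //.
    rewrite /F /= in_itv/= u1 andbT -[leRHS]invrK lef_pV2 ?posrE ?invr_gt0//.
    by rewrite (le_trans (ltW (truncnS_gt _)))// ler_nat.
  by move=> [n _]; rewrite /F /= !in_itv/= => /andP[nu ->]; rewrite (lt_le_trans _ nu).
have mf D : measurable_fun D (fun u : R => (u `^ (a - 1))%:E).
  by apply/measurable_EFinP; apply: measurable_funTS; exact: measurable_powR.
have cvgF : (\int[lebesgue_measure]_(u in F n) (u `^ (a - 1))%:E)%E
    @[n --> \oo] --> (\int[lebesgue_measure]_(u in \bigcup_n F n) (u `^ (a - 1))%:E)%E.
  apply: ge0_nondecreasing_set_cvg_integral => //.
  - move=> m n mn; apply/subsetPset => u; rewrite /F /= !in_itv/= => /andP[mu ->].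
    by rewrite andbT (le_trans _ mu)// lef_pV2 ?posrE// ler_nat !ltnS.
  - by move=> n; exact: measurable_itv.
  - by move=> n; exact: mf.
  - by move=> n u _; rewrite lee_fin powR_ge0.
rewrite -(cvg_lim _ cvgF)//; apply: lime_le; first by apply/cvg_ex; eexists; exact: cvgF.
apply: nearW => n.
have n1 : (n.+2%:R)^-1 < 1 :> R by rewrite invf_lt1// ltr1n.
have n0 : 0 < (n.+2%:R)^-1 :> R by rewrite invr_gt0.
have ca y : 0 < y -> {for y, continuous (fun u : R => a^-1 * u `^ a)}.
  by move=> y0; apply: continuousM; [exact: cst_continuous|exact: continuous_powR].
rewrite (@continuous_FTC2 _ _ (fun u => a^-1 * u `^ a))//.
- rewrite -EFinB lee_fin powR1 mulr1 gerBl mulr_ge0 ?powR_ge0 ?invr_ge0//.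
  exact: ltW.
- apply: continuous_in_subspaceT => y; rewrite inE/= in_itv/= => /andP[ny _].
  by apply: continuous_powR; exact: lt_le_trans ny.
- split.
  + move=> y; rewrite in_itv/= => /andP[ny _].
    have y0 : 0 < y by exact: lt_trans ny.
    by apply: derivableM => //; have [] := is_derive1_powR a y0.
  + by apply: cvg_at_right_filter; exact: ca.
  + by apply: cvg_at_left_filter; exact: ca.
- move=> y; rewrite in_itv/= => /andP[ny _].
  have y0 : 0 < y by exact: lt_trans ny.
  have [dy dE] := is_derive1_powR a y0.
  by rewrite derive1Ml// derive1E dE mulKf ?gt_eqF.
Qed.

(** A real-valued integral is 0 by default when it diverges, so positivity includes finiteness: near
    0 by comparison with the power, beyond 1 by [gamma_tail1], which also supplies the strict
    sign. *)
Lemma Gamma_gt0 (R : realType) (a : R) : 0 < a -> 0 < Gamma R a.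
Proof.
move=> a0; rewrite /Gamma.
have -> : (fun u : R => u `^ (a - 1) * expR (- u)) = gamma_density a 1.
  by apply/funext => u; rewrite /gamma_density mul1r.
have mg D : measurable_fun D (fun u : R => (gamma_density a 1 u)%:E).
  by apply/measurable_EFinP; exact: measurable_gamma_density.
have g0 (u : R) : (0 <= (gamma_density a 1 u)%:E)%E.
  by rewrite lee_fin gamma_density_ge0.
have -> : `]0, +oo[%classic = `]0, 1] `|` `]1, +oo[ :> set R.
  apply/seteqP; split => u /=; rewrite !in_itv/= !andbT.
    by move=> u0; rewrite u0/=; case: (leP u 1) => _; [left|right].
  by move=> [/andP[]//|u1]; exact: lt_trans u1.
rewrite /Rintegral ge0_integral_setU//; last 2 first.
- exact: mg.
- apply/disj_set2P; rewrite -subset0 => u /=; rewrite !in_itv/= andbT.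
  by move=> [/andP[_ u1]]; rewrite ltNge u1.
rewrite -EFin_gamma_tail1//.
set I := (X in fine (X + _)).
have I0 : (0 <= I)%E by apply: integral_ge0 => u _.
have Ifin : I \is a fin_num.
  rewrite ge0_fin_numE//; apply: le_lt_trans (ltry a^-1).
  apply: le_trans (integral_powR01_le a0).
  apply: ge0_le_integral => //; first exact: mg.
    by apply/measurable_EFinP; apply: measurable_funTS; exact: measurable_powR.
  move=> u /=; rewrite in_itv/= => /andP[u0 _].
  rewrite lee_fin /gamma_density ler_piMr ?powR_ge0// -[leRHS]expR0 ler_expR.
  by rewrite mul1r oppr_le0 ltW.
rewrite fineD// ltr_wpDl ?fine_ge0//=.
by rewrite gamma_tail1_gt0 ?ltr01 ?ltW.
Qed.

(** The substitution [u = x * y]. *)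
Lemma gamma_tail_scale (R : realType) (a x : R) : 0 < x ->
  \int[lebesgue_measure]_(u in `]x, +oo[) (u `^ (a - 1) * expR (- u)) =
  x `^ a * gamma_tail1 a x.
Proof.
move=> x0.
have -> : (fun u : R => u `^ (a - 1) * expR (- u)) = gamma_density a 1.
  by apply/funext => u; rewrite /gamma_density mul1r.
have mg b z D : measurable_fun D (fun u : R => (gamma_density b z u)%:E).
  by apply/measurable_EFinP; exact: measurable_gamma_density.
have dF : derive1 ( *%R x) = cst x.
  apply/funext => y; rewrite derive1Ml// ?derive1_id ?mulr1//.
rewrite /gamma_tail1 -RintegralZl//; last exact: integrable_gamma_density.
rewrite /Rintegral; congr fine.
(* The left end is closed for the change of variables, and [x] is then written [x * 1], the image of
   1. *)
rewrite integral_itv_obnd_cbnd//.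
rewrite -[X in `[X, +oo[](mulr1 x).
rewrite (@increasing_ge0_integration_by_substitutiony _ ( *%R x)); last 8 first.
all: rewrite ?dF.
- by move=> y z _ _; rewrite ltr_pM2l.
- by move=> y _; exact: cst_continuous.
- exact: is_cvg_cst.
- exact: is_cvg_cst.
- split; first by move=> y _; apply: derivableM.
  by apply: cvg_at_right_filter; apply: continuousM => //; exact: cst_continuous.
- by apply: gt0_cvgMry => //; exact: cvg_id.
- rewrite mulr1; apply: continuous_in_subspaceT => y; rewrite inE/= in_itv/= andbT => xy.
  have y0 : 0 < y by exact: lt_le_trans xy.
  apply: (@continuousM _ _ (fun u : R => u `^ (a - 1)) (fun u : R => expR (- (1 * u)))); first exact: continuous_powR.
  apply: continuous_comp; last exact: continuous_expR.
  by apply: continuousN; apply: continuousM => //; exact: cst_continuous.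
- by move=> y _; exact: gamma_density_ge0.
rewrite -integral_itv_obnd_cbnd//; last first.
  by apply/measurable_EFinP; apply: measurable_funM => //;
    apply: measurableT_comp => //; exact: measurable_gamma_density.
apply: eq_integral => y; rewrite inE/= in_itv/= andbT => y1.
have y0 : 0 < y by exact: lt_trans y1.
transitivity (gamma_density a 1 (x * y) * x)%:E => //.
rewrite !gamma_densityE ?mulr_gt0// /powR gt_eqF//; congr EFin.
rewrite -{3}[x]lnK ?posrE// -!expRD lnM ?posrE//; congr expR.
by ring.
Qed.

(** * Suprema of sublevel sets *)

(** Linear growth makes the sublevel set bounded and monotonicity gives the converse direction.
    Convexity along unit steps plays the part of right-continuity: if [f s < C], some [s + t] with
    [t > 0] is still in the set. *)
Lemma sup_sublevel_le (R : realType) (f : R -> R) (C kappa s : R) :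
  0 < kappa -> (forall u, 0 <= u -> kappa * u <= f u) ->
  (forall u w, 0 <= u -> u <= w -> f u <= f w) ->
  (forall u t, 0 <= u -> 0 <= t <= 1 -> f (u + t) <= (1 - t) * f u + t * f (u + 1)) ->
  f 0 < C ->
  sup [set u | 0 <= u /\ f u < C] <= s <-> 0 <= s /\ C <= f s.
Proof.
move=> k0 grow incr conv f0C; set A := (X in sup X).
have A0 : A 0 by split.
have ubA : has_sup A.
  split; first by exists 0.
  exists (C / kappa) => u [u0 fuC]; rewrite ler_pdivlMr// mulrC.
  exact: le_trans (grow u u0) (ltW fuC).
split=> [supAs|[s0 Cfs]]; last first.
  apply: ge_sup; first by exists 0.
  move=> u [u0 fuC]; rewrite leNgt; apply/negP => su.
  by have := le_lt_trans (le_trans Cfs (incr _ _ s0 (ltW su))) fuC; rewrite ltxx.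
have s0 : 0 <= s by apply: le_trans supAs; exact: ub_le_sup ubA.2 _ A0.
split => //; rewrite leNgt; apply/negP => fsC.
(* This [t] is at most 1 and satisfies [t * e < C - f s], so the chord bound [f s + t * e] stays
   below [C]. *)
pose e := f (s + 1) - f s; pose t := (C - f s) / (C - f s + e).
have d0 : 0 < C - f s by rewrite subr_gt0.
have e0 : 0 <= e by rewrite subr_ge0 incr// lerDl.
have de0 : 0 < C - f s + e by exact: ltr_wpDr.
have t0 : 0 < t by exact: divr_gt0.
have t1 : t <= 1 by rewrite ler_pdivrMr// mul1r lerDl.
have fst : f (s + t) < C.
  apply: le_lt_trans (conv s t s0 _) _; first by rewrite (ltW t0).
  have te : t * e < C - f s.
    rewrite /t mulrAC ltr_pdivrMr// ltr_pM2l// ltrDr//.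
  rewrite /e in te; lra.
have Ast : A (s + t) by split => //; rewrite addr_ge0// ltW.
by have := le_trans (ub_le_sup ubA.2 Ast) supAs; rewrite gerDl leNgt t0.
Qed.

(** * The mixture of exponentials and its relation to the boundary *)

(** Here lambda is [ln y / c], and the normalizing constant [gamma_tail1 k k], with
    [k = rho / c ^+ 2], is left out. Values are extended reals, as Tonelli's theorem expects. *)
Definition poisson_mixture (R : realType) (c rho s v : R) : \bar R :=
  (\int[lebesgue_measure]_(y in `]1%R, +oo[)
     (expR (ln y / c * s - psi_poisson R c (ln y / c) * v) *
      gamma_density (rho / c ^+ 2) (rho / c ^+ 2) y)%:E)%E.

(** Conjugacy: in [y], the Poisson exponential is a power times an exponential, so it adds
    [(c * s + v) / c ^+ 2] to the shape and [v / c ^+ 2] to the rate. *)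
Lemma poisson_mixtureE (R : realType) (c rho s v : R) :
  0 < c -> 0 < rho -> 0 <= v ->
  poisson_mixture c rho s v = (expR (v / c ^+ 2) *
    gamma_tail1 ((c * s + v + rho) / c ^+ 2) ((v + rho) / c ^+ 2))%:E.
Proof.
move=> c0 rho0 v0.
have : 0 < (v + rho) / c ^+ 2 by rewrite divr_gt0 ?exprn_gt0// ltr_wpDl.
move aE : ((c * s + v + rho) / c ^+ 2) => a.
move xE : ((v + rho) / c ^+ 2) => x x0.
rewrite EFinM EFin_gamma_tail1//.
rewrite -ge0_integralZl_EFin; [| | | |exact: expR_ge0]; last 3 first.
- by [].
- by move=> y _; rewrite lee_fin gamma_density_ge0.
- by apply/measurable_EFinP; exact: measurable_gamma_density.
apply: eq_integral => y; rewrite inE/= in_itv/= andbT => y1.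
have y0 : 0 < y by exact: lt_trans y1.
rewrite -EFinM !gamma_densityE// -!expRD -aE -xE; congr (expR _)%:E.
rewrite /psi_poisson [c * (_ / c)]mulrC divfK ?gt_eqF// lnK ?posrE//.
by field; rewrite gt_eqF.
Qed.

(** After scaling both tails to start at 1, the Gamma values and the powers cancel; [s >= 0] keeps
    the shape positive, so the divisions are genuine. *)
Lemma gamma_poisson_mixtureE (R : realType) (c rho s v : R) :
  0 < c -> 0 < rho -> 0 <= s -> 0 <= v ->
  gamma_poisson_mixture R c rho s v = expR (v / c ^+ 2) *
    gamma_tail1 ((c * s + v + rho) / c ^+ 2) ((v + rho) / c ^+ 2) /
    gamma_tail1 (rho / c ^+ 2) (rho / c ^+ 2).
Proof.
move=> c0 rho0 s0 v0; rewrite /gamma_poisson_mixture /reg_upper_gamma.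
set k := rho / _; set a := (c * s + _ + _) / _; set x := (v + rho) / _.
have c20 : 0 < c ^+ 2 by rewrite exprn_gt0.
have k0 : 0 < k by rewrite divr_gt0.
have x0 : 0 < x by rewrite divr_gt0// ltr_wpDl.
have a0 : 0 < a.
  by rewrite divr_gt0// ltr_wpDl// addr_ge0// mulr_ge0// ltW.
rewrite !gamma_tail_scale//.
have cancel (g1 g2 p1 p2 j1 j2 e : R) : g1 != 0 -> g2 != 0 -> p1 != 0 ->
    p2 != 0 -> j1 != 0 ->
    p1 / (g1 * (p1 * j1 / g1)) * (g2 * (p2 * j2 / g2) / p2) * e = e * j2 / j1.
  by move=> g10 g20 p10 p20 j10; field; rewrite g10 g20 p10 p20 j10.
by apply: cancel; rewrite gt_eqF ?Gamma_gt0 ?powR_gt0 ?gamma_tail1_gt0 ?(ltW k0).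
Qed.

(** This is [m(0, v) <= 1] with [w = v / c ^+ 2]: at [s = 0] the exponentials are at most 1 because
    psi is nonnegative, which here reads [ln y <= y - 1]. *)
Lemma poisson_gamma_tail1_le (R : realType) (k w : R) : 0 < k -> 0 <= w ->
  expR w * gamma_tail1 (w + k) (w + k) <= gamma_tail1 k k.
Proof.
move=> k0 w0; have wk0 : 0 < w + k by exact: ltr_wpDl.
rewrite /gamma_tail1 -RintegralZl//; last exact: integrable_gamma_density.
apply: le_Rintegral => //; last 2 first.
- exact: integrable_gamma_density.
- move=> y /=; rewrite in_itv/= andbT => y1.
  have y0 : 0 < y by exact: lt_trans y1.
  rewrite !gamma_densityE// -expRD ler_expR -subr_ge0.
  have -> : (k - 1) * ln y - k * y - (w + ((w + k - 1) * ln y - (w + k) * y)) =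
    w * (y - 1 - ln y) by ring.
  rewrite mulr_ge0// subr_ge0 -[in leLHS](subrK 1 y) addrC le_ln1Dx//.
  by rewrite -subr_gt0 opprK subrK.
exact: (integrableZl _ _ (integrable_gamma_density _ wk0)).
Qed.

(** Replaces the supremum by a condition on the mixture, whose measurability in [(s, v)] follows
    from Tonelli's theorem. *)
Lemma GP_leP (R : realType) (c rho l0 alpha s v : R) :
  0 < c -> 0 < rho -> 1 <= l0 -> 0 < alpha -> alpha < 1 -> 0 <= v ->
  GP R c rho l0 alpha v <= s <-> 0 <= s /\
    ((l0 / alpha * gamma_tail1 (rho / c ^+ 2) (rho / c ^+ 2))%:E <=
     poisson_mixture c rho s v)%E.
Proof.
move=> c0 rho0 l01 alpha0 alpha1 v0.
have c20 : 0 < c ^+ 2 by rewrite exprn_gt0.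
set k := rho / c ^+ 2; set x := (v + rho) / c ^+ 2.
have k0 : 0 < k by rewrite divr_gt0.
have x0 : 0 < x by rewrite divr_gt0// ltr_wpDl.
have J0 : 0 < gamma_tail1 k k by exact: gamma_tail1_gt0 (ltW k0).
pose a u := (c * u + v + rho) / c ^+ 2.
pose f u := expR (v / c ^+ 2) * gamma_tail1 (a u) x / gamma_tail1 k k.
have aE u : a u = u / c + x by rewrite /a /x; field; rewrite gt_eqF.
have -> : GP R c rho l0 alpha v = sup [set u | 0 <= u /\ f u < l0 / alpha].
  congr sup; apply/seteqP; split => u /= [u0].
    by rewrite gamma_poisson_mixtureE.
  by move=> fu; split => //; rewrite gamma_poisson_mixtureE.
have e0 : 0 < expR (v / c ^+ 2) / gamma_tail1 k k by rewrite divr_gt0 ?expR_gt0.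
have fE u : f u = expR (v / c ^+ 2) / gamma_tail1 k k * gamma_tail1 (a u) x.
  by rewrite /f mulrAC.
(* The slope comes from [gamma_tail1_ge] and [2 ^ (a u) >= 1 + a u * ln 2 >= u / c * ln 2]. *)
rewrite (@sup_sublevel_le _ f _ (expR (v / c ^+ 2) / gamma_tail1 k k *
  (ln 2 / c / 3 * expR (- (3 * x))))).
- rewrite poisson_mixtureE// lee_fin /f ler_pdivlMr//.
- by rewrite mulr_gt0// mulr_gt0 ?expR_gt0// !divr_gt0// ln_gt0// ltr1n.
- move=> u u0; rewrite fE -mulrA ler_wpM2l ?(ltW e0)//.
  have au0 : 0 <= a u by rewrite aE addr_ge0 ?(ltW x0)// divr_ge0// ltW.
  apply: le_trans (gamma_tail1_ge x0 au0).
  rewrite mulrAC ler_wpM2r ?expR_ge0// [_ / 3 * _]mulrAC ler_wpM2r ?invr_ge0//.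
  rewrite /powR gt_eqF//; apply: le_trans (expR_ge1Dx _).
  have -> : ln 2 / c * u = u / c * ln 2 by ring.
  rewrite aE mulrDl addrCA lerDl addr_ge0// mulr_ge0 ?(ltW x0)//.
  by rewrite ln_ge0// ler1n.
- move=> u w u0 uw; rewrite !fE ler_wpM2l ?(ltW e0)// le_gamma_tail1//.
  by rewrite !aE lerD2r ler_wpM2r ?invr_ge0 ?(ltW c0).
- move=> u t u0 t01; rewrite !fE !(mulrCA _ (_ / _)) -mulrDr ler_wpM2l ?(ltW e0)//.
  have -> : a (u + t) = (1 - t) * a u + t * a (u + 1) by rewrite !aE; ring.
  exact: gamma_tail1_convex.
(* [1 < l0 / alpha] because [alpha < 1 <= l0]. *)
- apply: (@le_lt_trans _ _ 1); last first.
    by rewrite ltr_pdivlMr// mul1r (lt_le_trans alpha1).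
  rewrite /f ler_pdivrMr// mul1r aE mul0r add0r.
  have -> : x = v / c ^+ 2 + k by rewrite /x mulrDl.
  by apply: poisson_gamma_tail1_le => //; rewrite divr_ge0// ltW.
Qed.

(** * Tonelli's theorem on rectangles *)

(** Extension by zero outside [A * B] reduces integrals over a rectangle to integrals over the whole
    product. *)
Lemma restrict_setX_integral d1 d2 (T1 : measurableType d1)
    (T2 : measurableType d2) (R : realType) (m : {measure set T2 -> \bar R})
    (f : T1 * T2 -> \bar R) (A : set T1) (B : set T2) x :
  (\int[m]_y ((f \_ (A `*` B)) (x, y)) =
   ((fun x => \int[m]_(y in B) f (x, y)) \_ A) x)%E.
Proof.
rewrite patchE; case: ifPn => xA.
  rewrite [RHS]integral_mkcond; apply: eq_integral => y _.
  by rewrite !patchE in_setX/= xA.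
by apply: integral0_eq => y _; rewrite patchE in_setX/= (negbTE xA).
Qed.

Lemma measurable_restrict_setX d1 d2 (T1 : measurableType d1)
    (T2 : measurableType d2) (R : realType) (f : T1 * T2 -> \bar R)
    (A : set T1) (B : set T2) :
  measurable_fun setT f -> measurable A -> measurable B ->
  measurable_fun setT (f \_ (A `*` B)).
Proof.
move=> mf mA mB; apply: (measurable_restrictT _ (measurableX mA mB)).1.
exact: measurable_funTS.
Qed.

Lemma measurable_fun_section_integral d1 d2 (T1 : measurableType d1)
    (T2 : measurableType d2) (R : realType)
    (m : {sigma_finite_measure set T2 -> \bar R}) (f : T1 * T2 -> \bar R)
    (B : set T2) :
  measurable_fun setT f -> (forall z, (0 <= f z)%E) -> measurable B ->
  measurable_fun setT (fun x => \int[m]_(y in B) f (x, y))%E.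
Proof.
move=> mf f0 mB; have := measurable_fun_fubini_tonelli_F (m2 := m) _
  (measurable_restrict_setX mf measurableT mB)
  (fun z => erestrict_ge0 (fun z _ => f0 z) z).
by apply: eq_measurable_fun => x _; rewrite /fubini_F restrict_setX_integral patchT ?inE.
Qed.

Lemma fubini_tonelli_setX d1 d2 (T1 : measurableType d1) (T2 : measurableType d2)
    (R : realType) (m1 : {sigma_finite_measure set T1 -> \bar R})
    (m2 : {sigma_finite_measure set T2 -> \bar R}) (f : T1 * T2 -> \bar R)
    (A : set T1) (B : set T2) :
  measurable_fun setT f -> (forall z, (0 <= f z)%E) ->
  measurable A -> measurable B ->
  (\int[m1]_(x in A) \int[m2]_(y in B) f (x, y) =
   \int[m2]_(y in B) \int[m1]_(x in A) f (x, y))%E.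
Proof.
move=> mf f0 mA mB.
have := fubini_tonelli (m1 := m1) (m2 := m2) _
  (measurable_restrict_setX mf mA mB)
  (fun z => erestrict_ge0 (fun z _ => f0 z) z).
under eq_integral do rewrite restrict_setX_integral.
rewrite -integral_mkcond => ->; rewrite [RHS]integral_mkcond.
apply: eq_integral => y _; rewrite patchE; case: ifPn => yB.
  rewrite [RHS]integral_mkcond; apply: eq_integral => x _.
  by rewrite !patchE in_setX/= yB andbT.
by apply: integral0_eq => x _; rewrite patchE in_setX/= (negbTE yB) andbF.
Qed.

(** * Mixing the stopped bounds over lambda *)

Lemma measurable_poisson_integrand d (T : measurableType d) (R : realType)
    (c rho : R) (S V : T -> R) :
  measurable_fun setT S -> measurable_fun setT V ->
  measurable_fun [set: T * measurableTypeR R] (fun z : T * R =>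
    (expR (ln z.2 / c * S z.1 - psi_poisson R c (ln z.2 / c) * V z.1) *
     gamma_density (rho / c ^+ 2) (rho / c ^+ 2) z.2)%:E).
Proof.
move=> mS mV; apply/measurable_EFinP.
have mlam : measurable_fun [set: T * measurableTypeR R] (fun z : T * R => ln z.2 / c).
  apply: measurable_funM => //.
  exact: (measurableT_comp (@measurable_ln R) measurable_snd).
apply: measurable_funM; last first.
  by apply: measurableT_comp => //; exact: measurable_gamma_density.
apply: measurableT_comp => //; apply: measurable_funB; apply: measurable_funM => //.
- exact: measurableT_comp.
- apply: measurable_funM => //; apply: measurable_funB => //.
  apply: measurable_funB; last exact: measurable_funM.
  by apply: measurableT_comp => //; exact: measurable_funM.
- exact: measurableT_comp.
Qed.

Lemma measurable_poisson_mixture d (T : measurableType d) (R : realType)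
    (c rho : R) (S V : T -> R) :
  measurable_fun setT S -> measurable_fun setT V ->
  measurable_fun setT (fun w => poisson_mixture c rho (S w) (V w)).
Proof.
move=> mS mV.
apply: (measurable_fun_section_integral lebesgue_measure
  (measurable_poisson_integrand c rho mS mV)) => // z.
by rewrite lee_fin mulr_ge0 ?expR_ge0 ?gamma_density_ge0.
Qed.

(** The bound of [sub_psi_first_hit] at lambda [ln y / c] is integrated against the gamma density in
    [y]; its constant right side [l0] yields the factor [gamma_tail1]. *)
Lemma sub_poisson_mixture_first_hit (R : realType) (c rho l0 : R)
    d (T : measurableType d) (P : probability T R)
    (F : nat -> set (set T)) (S V : nat -> T -> R) (D : nat -> set T) (N : nat) :
  0 < c -> 0 < rho -> 0 <= l0 ->
  sub_psi R (psi_poisson R c) +oo%E l0 d T P F S V ->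
  (forall t, F t (D t)) ->
  (\sum_(t < N) \int[P]_(w in seqDU D t) poisson_mixture c rho (S t w) (V t w)
   <= (l0 * gamma_tail1 (rho / c ^+ 2) (rho / c ^+ 2))%:E)%E.
Proof.
move=> c0 rho0 l00 subP FD; have [[_ Fm _] [adS adV] _ _ _] := subP.
have k0 : 0 < rho / c ^+ 2 by rewrite divr_gt0 ?exprn_gt0.
have mD t : measurable (D t) by exact: Fm.
have mA t : measurable (seqDU D t) by exact: seqDU_measurable.
have mS t : measurable_fun setT (S t) := rv_wrt_measurable_fun (Fm t) (adS t).
have mV t : measurable_fun setT (V t) := rv_wrt_measurable_fun (Fm t) (adV t).
pose g t (z : T * R) := (expR (ln z.2 / c * S t z.1 -
  psi_poisson R c (ln z.2 / c) * V t z.1) *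
  gamma_density (rho / c ^+ 2) (rho / c ^+ 2) z.2)%:E.
have mg t : measurable_fun [set: T * measurableTypeR R] (g t).
  exact: measurable_poisson_integrand.
have g0 t z : (0 <= g t z)%E.
  by rewrite lee_fin mulr_ge0 ?expR_ge0 ?gamma_density_ge0.
have swap t : (\int[P]_(w in seqDU D t) poisson_mixture c rho (S t w) (V t w) =
    \int[lebesgue_measure]_(y in `]1%R, +oo[) \int[P]_(w in seqDU D t) g t (w, y))%E.
  by rewrite -(fubini_tonelli_setX P lebesgue_measure (mg t)).
under eq_bigr do rewrite swap.
have mI t : measurable_fun (`]1, +oo[%classic : set (measurableTypeR R))
    (fun y : R => \int[P]_(w in seqDU D t) g t (w, y))%E.
  apply: measurable_funTS.
  (* Coordinates are swapped because that lemma integrates out the second one. *)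
  apply: (measurable_fun_section_integral P (f := fun z => g t (z.2, z.1))) => //.
  by apply: measurableT_comp (mg t) _; exact: measurable_swap.
rewrite -ge0_integral_sum//; last by move=> t y _; exact: integral_ge0.
rewrite EFinM EFin_gamma_tail1// -ge0_integralZl_EFin//; last 2 first.
- by move=> y _; rewrite lee_fin gamma_density_ge0.
- by apply/measurable_EFinP; exact: measurable_gamma_density.
apply: ge0_le_integral => //.
- by move=> y _; apply: sume_ge0 => t _; exact: integral_ge0.
- by apply: emeasurable_sum => t; exact: mI.
- by apply: measurable_funeM; apply/measurable_EFinP; exact: measurable_gamma_density.
move=> y /=; rewrite in_itv/= andbT => y1.
(* Mixing over [y > 1] only produces admissible, nonnegative lambda. *)
have lam0 : 0 <= ln y / c by rewrite divr_ge0 ?ln_ge0 ?ltW.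
have mf t : measurable_fun setT (fun w => (expR (ln y / c * S t w -
    psi_poisson R c (ln y / c) * V t w))%:E).
  apply/measurable_EFinP; apply: measurableT_comp => //.
  by apply: measurable_funB; exact: measurable_funM.
have pull t : (\int[P]_(w in seqDU D t) g t (w, y) =
    (gamma_density (rho / c ^+ 2) (rho / c ^+ 2) y)%:E *
    \int[P]_(w in seqDU D t) (expR (ln y / c * S t w -
      psi_poisson R c (ln y / c) * V t w))%:E)%E.
  rewrite -ge0_integralZl_EFin ?gamma_density_ge0//; last first.
    by apply: measurable_funTS; exact: mf.
  by apply: eq_integral => w _; rewrite muleC.
under eq_bigr do rewrite pull.
rewrite -ge0_sume_distrr; last first.
  by move=> t _; apply: integral_ge0 => w _; rewrite lee_fin expR_ge0.
rewrite muleC lee_wpmul2r ?lee_fin ?gamma_density_ge0//.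
exact: (sub_psi_first_hit N subP lam0 (ltry _) FD).
Qed.

(** * Crossing events and the bound on their probability *)

(** With [G] as the sigma-algebra of its own space, measurability lemmas yield events of [G] itself
    and not only of the ambient sigma-algebra. *)
Lemma measurable_gen_rv_wrt d (T : measurableType d) (R : realType)
    (G : set (set T)) (X : T -> R) : sigma_algebra setT G ->
  rv_wrt d T R G X -> measurable_fun [set: g_sigma_algebraType G] X.
Proof.
move=> sG GX _ B mB; rewrite setTI measurable_g_measurableTypeE//.
exact: GX.
Qed.

Unset Implicit Arguments.

Theorem proposition10 (R : realType) (c rho l0 alpha : R)
    (c_gt0 : 0 < c) (rho_gt0 : 0 < rho) (l0_ge1 : 1 <= l0)
    (alpha_gt0 : 0 < alpha) (alpha_lt1 : alpha < 1) :
  sub_poisson_uniform_boundary R c l0 alpha (GP R c rho l0 alpha).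
Proof.
move=> d T P F S V subP crossing.
have [[sF Fm ndF] [adS adV] _ V0 _] := subP.
have l00 : 0 < l0 by exact: lt_le_trans l0_ge1.
have k0 : 0 < rho / c ^+ 2 by rewrite divr_gt0 ?exprn_gt0.
set J := gamma_tail1 (rho / c ^+ 2) (rho / c ^+ 2).
have J0 : 0 < J by exact: gamma_tail1_gt0 (ltW k0).
(* The factor [J] compensates for the missing normalization of [poisson_mixture]. *)
pose C := l0 / alpha * J.
have C0 : 0 < C by rewrite mulr_gt0// divr_gt0.
pose D t := [set w | 0 <= S t w /\ (C%:E <= poisson_mixture c rho (S t w) (V t w))%E].
have FD t : F t (D t).
  have mS := measurable_gen_rv_wrt (sF t) (adS t).
  have mV := measurable_gen_rv_wrt (sF t) (adV t).
  rewrite -(measurable_g_measurableTypeE (sF t)).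
  have -> : D t = (S t @^-1` `[0, +oo[) `&`
      [set w | (C%:E <= poisson_mixture c rho (S t w) (V t w))%E].
    by apply/seteqP; split => w /=; rewrite in_itv/= andbT.
  apply: measurableI; first by rewrite -[X in measurable X]setTI; exact: mS.
  rewrite -[X in measurable X]setTI; apply: emeasurable_fun_c_infty => //.
  exact: measurable_poisson_mixture.
have mD t : measurable (D t) by exact: Fm.
have mA t : measurable (seqDU D t) by exact: seqDU_measurable.
have crossingE : crossing = \bigcup_(t in [set t | (1 <= t)%N]) D t.
  apply/seteqP; split => w.
    by move=> [t [t1 /GP_leP h]]; exists t => //; exact: h.
  by move=> [t t1 Dt]; exists t; split => //; apply/GP_leP.
have mcross : measurable crossing by rewrite crossingE; exact: bigcup_measurable.
split => //.
have mS t : measurable_fun setT (S t) := rv_wrt_measurable_fun (Fm t) (adS t).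
have mV t : measurable_fun setT (V t) := rv_wrt_measurable_fun (Fm t) (adV t).
have mUD : measurable (\bigcup_t D t) by exact: bigcup_measurable.
(* Including time 0 only enlarges the event. *)
apply: (@le_trans _ _ (P (\bigcup_t D t))).
  apply: le_measure; rewrite ?inE// crossingE.
  by move=> w [t _ Dt]; exists t.
rewrite seqDU_bigcup_eq measure_semi_bigcup//; last first.
  by rewrite -seqDU_bigcup_eq.
(* The first-entrance events are disjoint, so the probability is a limit of finite sums, each to be
   bounded by [alpha]. *)
apply: lime_le; first exact: is_cvg_nneseries.
apply: nearW => N; rewrite big_mkord.
have -> : alpha%:E = ((C^-1)%:E * (l0 * J)%:E)%E.
  by rewrite -EFinM /C; congr EFin; field; rewrite !gt_eqF.
rewrite lee_pdivlMl//.
apply: le_trans (sub_poisson_mixture_first_hit N c_gt0 rho_gt0 (ltW l00) subP FD).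
rewrite ge0_sume_distrr//; apply: lee_sum => t _.
(* Markov's inequality on each first-entrance event, where the mixture is at least [C]. *)
rewrite -integral_cst//; apply: ge0_le_integral => //.
- by move=> w _; rewrite lee_fin ltW.
- by apply: measurable_funTS; exact: measurable_poisson_mixture.
- by move=> w [[]].
Qed.
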